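(* Let $q$ be a prime power. For any finite set $A\subset\mathbb{F}_q((t^{-1}))$ and any $\epsilon>0$, \[ |A+A-A|^3\,|AA|^4 \gg_\epsilon q^{-2}|A|^{9-\epsilon}, \] where the implied constant depends only on $\epsilon$.
   Context: $\mathbb{F}_q((t^{-1}))$ is the field of formal Laurent series $\sum_{i=-\infty}^k\alpha_it^i$ with $\alpha_i\in\mathbb{F}_q$. $A+A-A=\{a+a'-a'':a,a',a''\in A\}$ and $AA=\{aa':a,a'\in A\}$. The notation $X\gg_\epsilon Y$ means $X\ge c(\epsilon)Y$ for a constant $c(\epsilon)>0$ depending only on $\epsilon$. *)

(* Defs.v *)
From HB Require Import structures.
From mathcomp Require Import all_boot all_order all_algebra.
From mathcomp Require Import finmap.
From mathcomp Require Import all_classical all_reals all_analysis.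
From mathcomp Require Import zify.

Set Implicit Arguments.
Unset Strict Implicit.
Unset Printing Implicit Defensive.

Import Order.TTheory GRing.Theory Num.Theory.

Local Open Scope ring_scope.

(* F((t^-1)): the series \sum_(i <= k) a_i t^i is encoded by its coefficient
   function i |-> a_i on int, which vanishes for all large enough i. *)
Record laurent (F : fieldType) := Laurent {
  lcoef :> int -> F;
  lcoef_bounded : exists k : int, forall i : int, k < i -> lcoef i = 0 }.

HB.instance Definition _ (F : fieldType) := gen_eqMixin (laurent F).
HB.instance Definition _ (F : fieldType) := gen_choiceMixin (laurent F).

Section LaurentField.
Variable F : fieldType.
Implicit Types f g h : laurent F.

Lemma laurentP f g : (forall i, f i = g i) -> f = g.
Proof.
case: f g => [f fb] [g gb] /= fg; have {fg} E : f = g by apply: funext.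
by case: _ / E gb => gb; congr Laurent; exact: Prop_irrelevance.
Qed.

Lemma lzero_bounded : exists k : int, forall i : int, k < i -> 0 = 0 :> F.
Proof. by exists 0. Qed.

Definition lzero := Laurent lzero_bounded.

Lemma lopp_bounded f : exists k : int, forall i : int, k < i -> - f i = 0.
Proof. by case: (lcoef_bounded f) => k H; exists k => i /H ->; rewrite oppr0. Qed.

Definition lopp f := Laurent (lopp_bounded f).

Lemma ladd_bounded f g :
  exists k : int, forall i : int, k < i -> f i + g i = 0.
Proof.
case: (lcoef_bounded f) (lcoef_bounded g) => k Hf [l Hg].
exists (Num.max k l) => i; rewrite gt_max => /andP[ki li].
by rewrite Hf // Hg // addr0.
Qed.

Definition ladd f g := Laurent (ladd_bounded f g).

Lemma laddA : associative ladd.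
Proof. by move=> f g h; apply: laurentP => i; exact: addrA. Qed.

Lemma laddC : commutative ladd.
Proof. by move=> f g; apply: laurentP => i; exact: addrC. Qed.

Lemma ladd0 : left_id lzero ladd.
Proof. by move=> f; apply: laurentP => i; exact: add0r. Qed.

Lemma laddN : left_inverse lzero lopp ladd.
Proof. by move=> f; apply: laurentP => i; exact: addNr. Qed.

HB.instance Definition _ :=
  GRing.isZmodule.Build (laurent F) laddA laddC ladd0 laddN.

Lemma lone_bounded :
  exists k : int, forall i : int, k < i -> (i == 0)%:R = 0 :> F.
Proof. by exists 0 => i /gt_eqF ->. Qed.

Definition lone := Laurent lone_bounded.

(* Cauchy product; for each n only finitely many terms are nonzero. *)
Definition lmul_coef f g (n : int) : F :=
  \sum_(i \in [set: int]) f i * g (n - i).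

Lemma lmul_coef_gt f g (M N n : int) :
  (forall i, M < i -> f i = 0) -> (forall i, N < i -> g i = 0) ->
  M + N < n -> lmul_coef f g n = 0.
Proof.
move=> fM gN Mn; apply: fsbig1 => i _.
have [/fM->|iM] := ltP M i; first by rewrite mul0r.
by rewrite (gN (n - i)) ?mulr0 //; lia.
Qed.

Lemma lmul_bounded f g :
  exists k : int, forall i : int, k < i -> lmul_coef f g i = 0.
Proof.
case: (lcoef_bounded f) (lcoef_bounded g) => M fM [N gN].
by exists (M + N) => i; exact: lmul_coef_gt.
Qed.

Definition lmul f g := Laurent (lmul_bounded f g).

Lemma lmul_coefE f g (M N : int) (k : nat) :
  (forall i, M < i -> f i = 0) -> (forall i, N < i -> g i = 0) ->
  lmul_coef f g (M + N - k%:Z) =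
  \sum_(j < k.+1) f (M - j%:Z) * g (N - (k - j)%N%:Z).
Proof.
move=> fM gN; rewrite /lmul_coef.
rewrite (fsbigE [seq M - j%:Z | j <- iota 0 k.+1]); first last.
- move=> i _ /mapP Hi.
  have [/fM->|iM] := ltP M i; first by rewrite mul0r.
  rewrite (gN (_ - i)) ?mulr0 // ltNge; apply/negP => H.
  apply: Hi; exists (absz (M - i)%R); last by lia.
  by rewrite mem_iota; lia.
- by [].
- by rewrite map_inj_uniq ?iota_uniq // => i j; lia.
under eq_bigl do rewrite in_setT.
rewrite big_map -{1}(subn0 k.+1) -/(index_iota 0 k.+1) big_mkord.
by apply: eq_bigr => j _; congr (_ * g _); have := ltn_ord j; lia.
Qed.

Definition ltrunc (K : nat) (M : int) f : {poly F} :=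
  \poly_(j < K) f (M - j%:Z).

Lemma lmul_trunc f g (M N : int) (K k : nat) :
  (forall i, M < i -> f i = 0) -> (forall i, N < i -> g i = 0) -> (k < K)%N ->
  lmul f g (M + N - k%:Z) = (ltrunc K M f * ltrunc K N g)`_k.
Proof.
move=> fM gN kK; rewrite /= lmul_coefE // coefM; apply: eq_bigr => j _.
by rewrite !coef_poly !ifT //; have := ltn_ord j; lia.
Qed.

Lemma coefM_eq (p q p' q' : {poly F}) (k : nat) :
  (forall j, (j <= k)%N -> p`_j = p'`_j) ->
  (forall j, (j <= k)%N -> q`_j = q'`_j) ->
  (p * q)`_k = (p' * q')`_k.
Proof.
move=> Hp Hq; rewrite !coefM; apply: eq_bigr => j _.
by rewrite Hp ?Hq //; have := ltn_ord j; lia.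
Qed.

Lemma lmulC : commutative lmul.
Proof.
move=> f g; apply: laurentP => n.
case: (lcoef_bounded f) (lcoef_bounded g) => M fM [N gN].
have [Mn|nM] := ltP (M + N) n.
  by rewrite /= (lmul_coef_gt fM gN) // (lmul_coef_gt gN fM) // (addrC N M).
have -> : n = M + N - (absz (M + N - n)%R)%:Z by lia.
by rewrite (lmul_trunc fM gN (ltnSn _)) (addrC M N)
  (lmul_trunc gN fM (ltnSn _)) mulrC.
Qed.

Lemma lmulA : associative lmul.
Proof.
move=> f g h; apply: laurentP => n.
case: (lcoef_bounded f) (lcoef_bounded g) (lcoef_bounded h)
  => M fM [N gN] [P hP].
have fgMN i : M + N < i -> lmul f g i = 0 by exact: lmul_coef_gt.
have ghNP i : N + P < i -> lmul g h i = 0 by exact: lmul_coef_gt.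
have [Mn|nM] := ltP (M + N + P) n.
  by rewrite /= (lmul_coef_gt fgMN hP) // (lmul_coef_gt fM ghNP) // addrA.
have -> : n = M + N + P - (absz (M + N + P - n)%R)%:Z by lia.
set k := absz _; rewrite (lmul_trunc fgMN hP (ltnSn k)) -(addrA M N P).
rewrite (lmul_trunc fM ghNP (ltnSn k)).
transitivity (ltrunc k.+1 M f * (ltrunc k.+1 N g * ltrunc k.+1 P h))`_k.
  apply: coefM_eq => // j jk.
  by rewrite coef_poly ifT // (lmul_trunc (K := k.+1) gN hP).
rewrite mulrA; apply: coefM_eq => // j jk.
by rewrite [RHS]coef_poly ifT // (lmul_trunc (K := k.+1) fM gN).
Qed.

Lemma lmul1 : left_id lone lmul.
Proof.
move=> f; apply: laurentP => n /=; rewrite /lmul_coef.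
rewrite (fsbigE [:: 0]) //=; last first.
  by move=> i _; rewrite inE => /negPf ->; rewrite mul0r.
by rewrite big_cons big_nil in_setT eqxx mul1r subr0 addr0.
Qed.

Lemma lmulDl : left_distributive lmul ladd.
Proof.
move=> f g h; apply: laurentP => n.
case: (lcoef_bounded f) (lcoef_bounded g) (lcoef_bounded h)
  => M0 fM0 [N0 gN0] [P hP].
pose M := Num.max M0 N0.
have fM i : M < i -> f i = 0 by rewrite gt_max => /andP[/fM0].
have gM i : M < i -> g i = 0 by rewrite gt_max => /andP[_ /gN0].
have fgM i : M < i -> ladd f g i = 0.
  by move=> Mi; rewrite /= fM // gM // addr0.
have [Mn|nM] := ltP (M + P) n.
  by rewrite /= (lmul_coef_gt fgM hP) // (lmul_coef_gt fM hP) //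
    (lmul_coef_gt gM hP) // addr0.
have -> : n = M + P - (absz (M + P - n)%R)%:Z by lia.
rewrite /= (lmul_coefE _ fgM hP) (lmul_coefE _ fM hP) (lmul_coefE _ gM hP).
by rewrite -big_split; apply: eq_bigr => j _; exact: mulrDl.
Qed.

Lemma lone_neq0 : lone != lzero.
Proof.
apply/eqP => /(congr1 (fun f : laurent F => f 0)) /=.
by move/eqP; rewrite oner_eq0.
Qed.

HB.instance Definition _ :=
  GRing.Zmodule_isComNzRing.Build (laurent F) lmulA lmulC lmul1 lmulDl lone_neq0.

Fixpoint psinv_seq (u : nat -> F) (n : nat) : seq F :=
  if n is m.+1 then
    let s := psinv_seq u m in
    rcons s (- (u 0%N)^-1 * \sum_(j < m.+1) u j.+1 * s`_(m - j))
  else [:: (u 0%N)^-1].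

Lemma size_psinv_seq u n : size (psinv_seq u n) = n.+1.
Proof. by elim: n => //= n IH; rewrite size_rcons IH. Qed.

Lemma nth_psinv_seq u n m : (m <= n)%N ->
  (psinv_seq u n)`_m = (psinv_seq u m)`_m.
Proof.
elim: n => [|n IH]; first by rewrite leqn0 => /eqP ->.
rewrite leq_eqVlt => /orP[/eqP -> //|]; rewrite ltnS => mn.
by rewrite /= nth_rcons size_psinv_seq ltnS mn IH.
Qed.

Lemma psinvP (u : nat -> F) : u 0%N != 0 ->
  exists v : nat -> F,
    forall k, \sum_(j < k.+1) u j * v (k - j)%N = (k == 0%N)%:R.
Proof.
move=> u0; exists (fun m => (psinv_seq u m)`_m) => -[|k].
  by rewrite big_ord_recl big_ord0 /= divff // addr0.
rewrite big_ord_recl subn0 /= nth_rcons size_psinv_seq ltnn eqxx.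
rewrite mulrA mulrN divff // mulN1r addrC; apply/eqP; rewrite subr_eq0.
apply/eqP; apply: eq_bigr => j _.
by rewrite /bump /= add1n subSS -(@nth_psinv_seq u k) // leq_subr.
Qed.

Lemma llead f : f != 0 ->
  exists2 M : int, f M != 0 & forall i, M < i -> f i = 0.
Proof.
case: (lcoef_bounded f) => k fk f0.
have : exists j : nat, f (k - j%:Z) != 0.
  apply: contrapT => H; move/eqP: f0; apply; apply: laurentP => i.
  have [/fk -> //|ik] := ltP k i.
  apply/eqP; apply: contrapT => /negP fi.
  by apply: H; exists (absz (k - i)%R); have -> : k - (absz (k - i)%R)%:Z = i by lia.
case/ex_minnP => j fj jmin; exists (k - j%:Z) => // i ji.
have [/fk -> //|ik] := ltP k i.
apply/eqP; apply: contraT => fi.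
have := jmin (absz (k - i)%R).
by have -> : k - (absz (k - i)%R)%:Z = i by [lia]; move/(_ fi); lia.
Qed.

Lemma lmulV_ex f : f != 0 -> exists g, g * f = 1.
Proof.
case/llead => M fM0 fM.
have [|v Hv] := @psinvP (fun j => f (M - j%:Z)); first by rewrite subr0.
pose c (i : int) : F := if i <= - M then v (absz (- M - i)%R) else 0.
have cb : exists k : int, forall i : int, k < i -> c i = 0.
  by exists (- M) => i; rewrite /c ltNge => /negPf ->.
exists (Laurent cb); rewrite mulrC; apply: laurentP => n.
rewrite /GRing.mul /GRing.one /=.
have gN i : - M < i -> Laurent cb i = 0.
  by rewrite /= /c ltNge => /negPf ->.
have [n0|n0] := ltP 0 n.
  by rewrite (lmul_coef_gt fM gN) ?subrr // gt_eqF.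
have -> : n = M + - M - (absz n)%:Z by lia.
rewrite (lmul_coefE _ fM gN).
have -> : (M + - M - (absz n)%:Z == 0) = ((absz n) == 0%N) by lia.
rewrite -Hv; apply: eq_bigr => j _ /=; rewrite /c ifT; last by lia.
by congr (_ * v _); lia.
Qed.

Definition linv f : laurent F :=
  if pselect (exists g, g * f = 1) is left e then projT1 (cid e) else 0.

Lemma lmulV f : f != 0 -> linv f * f = 1.
Proof.
move=> /lmulV_ex f0; rewrite /linv; case: pselect => // e.
by case: (cid e).
Qed.

Lemma linv0 : linv 0 = 0.
Proof.
rewrite /linv; case: pselect => // e; exfalso; case: e => g.
by rewrite mulr0 => /eqP; rewrite eq_sym oner_eq0.
Qed.

HB.instance Definition _ :=
  GRing.ComNzRing_isField.Build (laurent F) lmulV linv0.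

End LaurentField.

Local Open Scope fset_scope.

Definition addsub_fset (V : zmodType) (A : {fset V}) : {fset V} :=
  [fset a.1.1 + a.1.2 - a.2 | a in A `*` A `*` A].

Definition mul_fset (L : pzRingType) (A : {fset L}) : {fset L} :=
  [fset a * a' | a in A, a' in A].

(* Main.v *)
(* Let S = |A + A - A| and P = |AA|.  Sort A by degree and let A0 be its lower
   and A1 its upper half.  Join a, a' in A1 when a v = a' u has at least
   |A0|^2 / 2P solutions u, v in A0.  By Cauchy-Schwarz on the products, an
   independent set has at most 2P / |A0| elements; so, unless P is of order
   |A|^2, most a in A1 have a nearest neighbour a'.  For u, v as above,
   s = a + (v - u) is in A + A - A and in the ball of centre a and radius
   |a' - a|, since |u| <= |a|; and s, a determine u, v.  The balls that contain
   a given s are nested: if they have at most L distinct radii, there are at most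
   L q (2P / |A0|) of them, whence |A|^4 << P^2 S q L.
   If s is in balls of L radii, A contains L points at pairwise distinct distances
   from s.  Signed sums of 2h such points, taken from disjoint blocks of radii,
   are all distinct, so the Plunnecke inequality for A + h (A - A) gives
   (L / 2h)^(2h) <= (S / |A|)^h |A|, and 1 / h <= eps is chosen. *)

Require Import Defs.
From HB Require Import structures.
From mathcomp Require Import all_boot all_order all_algebra.
From mathcomp Require Import finmap.
From mathcomp Require Import all_classical all_reals all_analysis.
From mathcomp Require Import zify ring lra.

Set Implicit Arguments.
Unset Strict Implicit.
Unset Printing Implicit Defensive.

Import Order.TTheory GRing.Theory Num.Theory.

Local Open Scope ring_scope.

(** * Sum sets and the Plunnecke inequality *)

Definition sumset (V : zmodType) (A B : {fset V}) : {fset V} :=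
  [fset (a + b)%R | a in A, b in B]%fset.

Lemma sumsetP (V : zmodType) (A B : {fset V}) (x : V) :
  reflect (exists a b, [/\ a \in A, b \in B & x = a + b]) (x \in sumset A B).
Proof.
apply: (iffP idP) => [/imfset2P[/= a aA [b bB ->]]|[a [b [aA bB ->]]]].
  by exists a, b.
exact: in_imfset2.
Qed.

Lemma mem_sumset (V : zmodType) (A B : {fset V}) a b :
  a \in A -> b \in B -> a + b \in sumset A B.
Proof. by move=> aA bB; apply/sumsetP; exists a, b. Qed.

Lemma sumsetC (V : zmodType) (A B : {fset V}) : sumset A B = sumset B A.
Proof.
by apply/fsetP => x; apply/sumsetP/sumsetP => -[a [b [aA bB ->]]];
  exists b, a; rewrite addrC.
Qed.

Lemma sumsetSS (V : zmodType) (A B C D : {fset V}) :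
  (A `<=` C)%fset -> (B `<=` D)%fset -> (sumset A B `<=` sumset C D)%fset.
Proof.
move=> /fsubsetP AC /fsubsetP BD; apply/fsubsetP => x /sumsetP[a [b [aA bB ->]]].
by rewrite mem_sumset ?AC ?BD.
Qed.

Lemma card_translate (V : zmodType) (c : V) (A : {fset V}) :
  #|` sumset [fset c]%fset A| = #|` A|.
Proof.
rewrite (_ : sumset _ _ = [fset (c + a)%R | a in A]%fset).
  by rewrite card_imfset //; exact: addrI.
apply/fsetP => x; apply/sumsetP/imfsetP => /=.
  by move=> [_ [b [/fset1P -> bA ->]]]; exists b.
by move=> [b bA ->]; exists c, b; rewrite in_fset1 eqxx.
Qed.

Lemma card_sumset_le (V : zmodType) (A B : {fset V}) :
  A != fset0 -> (#|` B| <= #|` sumset A B|)%N.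
Proof.
case/fset0Pn => a aA; rewrite -(card_translate a B).
by rewrite fsubset_leq_card // sumsetSS // fsub1set.
Qed.

(* When [c] is added to [C], the sum set [c + X + B] brings
   nothing new from [c + Z + B], where [Z] collects the [x] with
   [c + x + B] already covered; minimality applied to [Z] closes the induction. *)
Lemma petridis (V : zmodType) (X B : {fset V}) :
  (forall Z : {fset V}, Z `<=` X ->
    #|` sumset X B| * #|` Z| <= #|` sumset Z B| * #|` X|)%fset%N ->
  forall C : {fset V},
    (#|` sumset C (sumset X B)| * #|` X| <= #|` sumset X B| * #|` sumset C X|)%N.
Proof.
move=> Xmin; elim/finSet_rect => C IH.
have [->|/fset0Pn[c cC]] := eqVneq C fset0.
  rewrite (_ : sumset _ _ = fset0) ?cardfs0 //.
  by apply/fsetP => x; rewrite in_fset0; apply/negP => /sumsetP[a [b []]].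
pose C0 := (C `\ c)%fset.
have {}IH := IH _ (fproperD1 cC).
pose XB := sumset X B.
pose Z := [fset x in X | (sumset [fset (c + x)%R] B `<=` sumset C0 XB)%fset]%fset.
have ZX : (Z `<=` X)%fset by exact: fset_sub.
have CE : C = (C0 `|` [fset c])%fset by rewrite fsetUC fsetD1K.
pose cZB := sumset [fset c]%fset (sumset Z B).
have cZsub : (cZB `<=` sumset [fset c]%fset XB)%fset.
  by rewrite sumsetSS // sumsetSS.
(* By the choice of [Z], all of [c + Z + B] is already covered by [C0 + X + B]. *)
have H1 : (#|` sumset C XB| <= #|` sumset C0 XB| + (#|` XB| - #|` sumset Z B|))%N.
  rewrite -(card_translate c XB) -(card_translate c (sumset Z B)) -/cZB.
  rewrite -cardfsDS //.
  rewrite -cardfsUI (leq_trans _ (leq_addr _ _)) //; apply: fsubset_leq_card.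
  apply/fsubsetP => x /sumsetP[a [y [aC yXB ->]]]; rewrite in_fsetU.
  move: aC; rewrite CE in_fsetU => /orP[aC0|/fset1P ->]; first by rewrite mem_sumset.
  rewrite in_fsetD (mem_sumset (fset11 c) yXB) andbT.
  have [cyZ|] := boolP (_ \in cZB); rewrite ?orbT //= orbF.
  move: cyZ => /sumsetP[_ [_ [/fset1P -> /sumsetP[z [b [zZ bB ->]]] ->]]].
  move: zZ; rewrite !inE => /andP[_ /fsubsetP]; apply.
  by rewrite addrA mem_sumset // fset11.
(* If [c + x] equals some [d + y] in [C0 + X], then [c + x + B] lies in [C0 + X + B], so [x] is in
   [Z]; every other [x] gives a new sum. *)
have H2 : (#|` sumset C0 X| + (#|` X| - #|` Z|) <= #|` sumset C X|)%N.
  have cZX : (sumset [fset c]%fset Z `<=` sumset [fset c]%fset X)%fset.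
    exact: sumsetSS.
  rewrite -(card_translate c X) -(card_translate c Z) -cardfsDS //.
  rewrite -cardfsUI [X in (_ + X)%N](_ : _ = 0%N) ?addn0.
    apply: fsubset_leq_card; rewrite fsubUset; apply/andP; split.
      by rewrite sumsetSS // fproper_sub // fproperD1.
    by rewrite (fsubset_trans (fsubsetDl _ _)) // sumsetSS // fsub1set.
  apply/eqP; rewrite cardfs_eq0; apply/eqP/fsetP => x; rewrite in_fset0.
  apply/negP; rewrite in_fsetI in_fsetD.
  move=> /andP[/sumsetP[d [y [dC yX ->]]] /andP[/negP nZ]].
  move=> /sumsetP[_ [z [/fset1P -> zX E]]]; apply: nZ.
  rewrite E mem_sumset ?fset11 // !inE zX /=.
  apply/fsubsetP => _ /sumsetP[_ [b [/fset1P -> bB ->]]].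
  by rewrite -E -addrA mem_sumset // mem_sumset.
have ZB : (#|` sumset Z B| <= #|` XB|)%N by rewrite fsubset_leq_card // sumsetSS.
have := Xmin _ ZX; rewrite -/XB in IH *.
have := fsubset_leq_card ZX.
move: IH H1 H2 ZB; rewrite -/C0.
move: #|` sumset C0 XB| #|` sumset C0 X| #|` sumset Z B| => p r zb.
move: #|` XB| #|` Z| #|` X| #|` sumset C XB| #|` sumset C X| => k z x P Q.
(* [P x <= (p + k - zb) x <= k (r + x - z) <= k Q], where the middle inequality is [IH] together
   with the minimality [k z <= zb x]. *)
by move=> IH H1 H2 zbk zx kz; nia.
Qed.


(** Descent on the ratio [|Z + B| / |Z|], cross-multiplied throughout: if [A] does not minimise it
    among its subsets, a proper nonempty subset has a smaller ratio and induction applies there. *)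
Lemma petridis_subset (V : zmodType) (B A : {fset V}) : A != fset0 ->
  exists X : {fset V}, [/\ X != fset0, (X `<=` A)%fset,
    (#|` sumset X B| * #|` A| <= #|` sumset A B| * #|` X|)%N &
    forall Z : {fset V}, (Z `<=` X)%fset ->
      (#|` sumset X B| * #|` Z| <= #|` sumset Z B| * #|` X|)%N].
Proof.
elim/finSet_rect: A => A IH A0.
have [Amin|/existsNP[Z /not_implyP[ZA /negP]]] := pselect (forall Z : {fset V},
  (Z `<=` A)%fset ->
  (#|` sumset A B| * #|` Z| <= #|` sumset Z B| * #|` A|)%N).
  by exists A; split.
rewrite -ltnNge => Zlt.
have Z0 : Z != fset0.
  by apply: contraTneq Zlt => ->; rewrite cardfs0 muln0 ltn0.
have ZltA : (Z `<` A)%fset.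
  rewrite fproperEneq ZA andbT; apply: contraTneq Zlt => ->.
  by rewrite ltnn.
have [X [X0 XZ XBZ Xmin]] := IH _ ZltA Z0.
exists X; split => //; first exact: fsubset_trans ZA.
have := Z0; rewrite -cardfs_gt0 => Z0'; rewrite -(leq_pmul2l Z0').
move: Z0' XBZ Zlt.
move: #|` sumset X B| #|` sumset A B| #|` sumset Z B| => xb ab zb.
move: #|` X| #|` A| #|` Z| => x a z Z0' XBZ Zlt.
apply: (@leq_trans ((zb * x) * a)); first by rewrite mulnA (mulnC z) leq_mul.
by rewrite mulnAC (mulnA z) (mulnC z) leq_mul // ltnW.
Qed.

(** [X] is chosen before [C], so the same [X] serves every time the inequality is iterated. *)
Lemma plunnecke (V : zmodType) (A B : {fset V}) : A != fset0 ->
  exists X : {fset V}, [/\ X != fset0, (X `<=` A)%fset &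
    forall C : {fset V},
      (#|` sumset C (sumset X B)| * #|` A| <= #|` sumset A B| * #|` sumset C X|)%N].
Proof.
move=> /(petridis_subset B)[X [X0 XA XBA Xmin]]; exists X; split => // C.
move: X0; rewrite -cardfs_gt0 => X0; rewrite -(leq_pmul2l X0).
move: X0 XBA (petridis Xmin C).
move: #|` sumset X B| #|` sumset A B| #|` sumset C (sumset X B)| => xb ab p.
move: #|` sumset C X| #|` X| #|` A| => cx x a X0 XBA H.
apply: (@leq_trans ((xb * cx) * a)); first by rewrite mulnA (mulnC x) leq_mul.
by rewrite mulnAC (mulnA x) (mulnC x) leq_mul.
Qed.

(** * Degrees and separated sets *)

(** The logarithm of the absolute value to base [q]; at the zero series the value 0 is only a
    default. *)
Definition deg (F : fieldType) (f : laurent F) : int :=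
  if pselect (f != 0) is left h then s2val (cid2 (llead h)) else 0.

Lemma degP (F : fieldType) (f : laurent F) : f != 0 -> f (deg f) != 0.
Proof.
rewrite /deg => f0; case: pselect => [h|/(_ f0)] //; exact: (s2valP (cid2 (llead h))).
Qed.

Lemma coef_gt_deg (F : fieldType) (f : laurent F) i : deg f < i -> f i = 0.
Proof.
rewrite /deg; case: pselect => [h|/negP]; first exact: (s2valP' (cid2 (llead h))).
by rewrite negbK => /eqP ->.
Qed.

Lemma deg_eq (F : fieldType) (f : laurent F) M :
  f M != 0 -> (forall i, M < i -> f i = 0) -> deg f = M.
Proof.
move=> fM fgt; have f0 : f != 0 by apply/eqP => fE; rewrite fE eqxx in fM.
apply/eqP; rewrite eq_le !leNgt; apply/andP; split; apply/negP => H.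
  by move: (degP f0); rewrite fgt ?eqxx.
by move: fM; rewrite coef_gt_deg ?eqxx.
Qed.

Lemma degN (F : fieldType) (f : laurent F) : deg (- f) = deg f.
Proof.
have [->|f0] := eqVneq f 0; first by rewrite oppr0.
by apply: deg_eq => [|i /coef_gt_deg fi]; rewrite /= ?oppr_eq0 ?degP // fi oppr0.
Qed.

Lemma degM (F : fieldType) (f g : laurent F) :
  f != 0 -> g != 0 -> deg (f * g) = deg f + deg g.
Proof.
move=> f0 g0; apply: deg_eq => [|i]; last first.
  by apply: lmul_coef_gt; exact: coef_gt_deg.
(* At the top exponent, [k = 0] in [lmul_coefE], the Cauchy sum has a single term. *)
have -> : deg f + deg g = deg f + deg g - 0%N%:Z by rewrite subr0.
rewrite /GRing.mul /= lmul_coefE; try exact: coef_gt_deg.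
by rewrite big_ord_recl big_ord0 !subr0 addr0 mulf_neq0 ?degP.
Qed.

Lemma degD_neq (F : fieldType) (f g : laurent F) :
  f != 0 -> g != 0 -> deg f != deg g ->
  deg (f + g) = Num.max (deg f) (deg g).
Proof.
wlog fg : f g / deg f < deg g => [H|f0 g0 _].
  move=> f0 g0 fg; have [lt|] := ltP (deg f) (deg g).
    by rewrite H // max_r // ltW.
  rewrite le_eqVlt eq_sym (negPf fg) /= => lt.
  by rewrite addrC H // 1?eq_sym // max_r // ltW.
rewrite max_r ?ltW //; apply: deg_eq => [|i gi].
  by rewrite [X in X != 0]/= (coef_gt_deg fg) add0r degP.
by rewrite /= !coef_gt_deg ?addr0 // (lt_trans fg).
Qed.

Definition diffs_deg_in (F : fieldType) (T : {fset laurent F}) (R : {fset int}) :=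
  forall x y, x \in T -> y \in T -> x != y -> deg (x - y) \in R.

(** A coincidence [t + w = t' + w'] with [t != t'] would put the degree of [t - t' = w' - w] in both
    [R] and [R']. When both differences are nonzero, their degrees are distinct, so the degree of
    their sum is the larger one. *)
Lemma diffs_deg_in_sumset (F : fieldType) (T W : {fset laurent F}) R R' :
  diffs_deg_in T R -> diffs_deg_in W R' -> [disjoint R & R']%fset ->
  #|` sumset T W| = (#|` T| * #|` W|)%N /\
  diffs_deg_in (sumset T W) (R `|` R')%fset.
Proof.
move=> TR WR' /fdisjointP RR'; split; last first.
  move=> _ _ /sumsetP[t [w [tT wW ->]]] /sumsetP[t' [w' [tT' wW' ->]]].
  rewrite in_fsetU; have [->|tt'] := eqVneq t t'.
    have [->|ww' _] := eqVneq w w'; first by rewrite eqxx.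
    by rewrite opprD addrACA subrr add0r WR' ?orbT.
  have [-> _|ww' _] := eqVneq w w'.
    by rewrite opprD addrACA subrr addr0 TR.
  have RT := TR _ _ tT tT' tt'; have RW := WR' _ _ wW wW' ww'.
  rewrite opprD addrACA degD_neq ?subr_eq0 //; last first.
    by apply: contraNneq (RR' _ RT) => ->.
  by rewrite maxEle; case: ifP; rewrite ?RT ?RW ?orbT.
rewrite (_ : #|` _| = size [seq t + w | t <- T, w <- W]); first by rewrite size_allpairs.
apply/perm_size/uniq_perm => //.
  apply: allpairs_uniq; rewrite ?fset_uniq // => -[t0 w0] [t1 w1].
  move=> /allpairsP[[t w] /= [tT wW [-> ->]]] /allpairsP[[t' w'] /= [tT' wW' [-> ->]]] E.
  have [tt'|tt'] := eqVneq t t'; first by move: E; rewrite tt' => /addrI ->.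
  have E' : t - t' = w' - w.
    by rewrite -(addrK w t) E; ring.
  have ww' : w' != w by rewrite -subr_eq0 -E' subr_eq0.
  by have := RR' _ (TR _ _ tT tT' tt'); rewrite E' WR'.
move=> x; apply/sumsetP/allpairsP => /=.
  by move=> [t [w [tT wW ->]]]; exists (t, w).
by move=> [[t w] [tT wW ->]]; exists t, w.
Qed.

Lemma fsubset_of_card (K : choiceType) (R : {fset K}) (m : nat) :
  (m <= #|` R|)%N -> exists2 R1 : {fset K}, (R1 `<=` R)%fset & #|` R1| = m.
Proof.
move=> mR; exists [fset x in take m R]%fset.
  by apply/fsubsetP => x; rewrite inE => /mem_take.
by rewrite card_fseq undup_id ?take_uniq // size_takel.
Qed.

Lemma diffs_deg_inW (F : fieldType) (T : {fset laurent F}) (R R' : {fset int}) :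
  (R `<=` R')%fset -> diffs_deg_in T R -> diffs_deg_in T R'.
Proof. by move=> /fsubsetP RR' TR x y xT yT xy; rewrite RR' ?TR. Qed.

Lemma diffs_deg_in_opp (F : fieldType) (T : {fset laurent F}) R :
  diffs_deg_in T R ->
  diffs_deg_in [fset - x | x in T]%fset R /\ #|` [fset - x | x in T]%fset| = #|` T|.
Proof.
move=> TR; split; last by rewrite card_imfset //; exact: oppr_inj.
move=> _ _ /imfsetP[/= x xT ->] /imfsetP[/= y yT ->]; rewrite eqr_opp => xy.
by rewrite -opprD degN TR.
Qed.

(** Two points at distinct distances from [s] are, by the ultrametric law, as far apart as the
    larger of these distances. *)
Lemma diffs_deg_in_image (F : fieldType) (s : laurent F) (u : int -> laurent F)
    (R : {fset int}) :
  (forall r, r \in R -> u r != s /\ deg (u r - s) = r) ->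
  diffs_deg_in [fset u r | r in R]%fset R /\ #|` [fset u r | r in R]%fset| = #|` R|.
Proof.
move=> uR; split; last first.
  rewrite card_in_imfset //= => r r' /uR[_ rE] /uR[_ rE'] E.
  by rewrite -rE -rE' E.
move=> _ _ /imfsetP[/= r rR ->] /imfsetP[/= r' rR' ->] rr'.
have [us ur] := uR _ rR; have [us' ur'] := uR _ rR'.
rewrite (_ : u r - u r' = (u r - s) + - (u r' - s)); last by rewrite opprB addrA subrK.
rewrite degD_neq ?oppr_eq0 ?subr_eq0 // degN ur ur'; last first.
  by apply: contraNneq rr' => ->.
by rewrite maxEle; case: ifP.
Qed.

(* Blocks of [m] radii each are used alternately with signs [+] and [-]; as
   distinct blocks have disjoint sets of degrees, all the [m ^ (2 h)] signed
   sums are distinct. *)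
Lemma separated_growth (F : fieldType) (A B X : {fset laurent F}) (N S : nat)
    (s : laurent F) (u : int -> laurent F) :
  (forall a a', a \in A -> a' \in A -> a - a' \in B) ->
  (forall C, #|` sumset C (sumset X B)| * N <= S * #|` sumset C X|)%N ->
  forall (h m : nat) (R : {fset int}),
    (forall r, r \in R -> [/\ u r \in A, u r != s & deg (u r - s) = r]) ->
    (2 * h * m <= #|` R|)%N ->
    exists T : {fset laurent F}, [/\ #|` T| = (m ^ (2 * h))%N, diffs_deg_in T R &
      (#|` sumset T X| * N ^ h <= S ^ h * #|` X|)%N].
Proof.
move=> AB XB; elim=> [|h IH] m R uR hR.
  exists [fset 0]%fset; rewrite cardfs1 card_translate.
  split=> //; last by rewrite muln1 mul1n.
  by move=> x y /fset1P -> /fset1P ->; rewrite eqxx.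
have {}hR : (m + m + 2 * h * m <= #|` R|)%N.
  by move: hR; rewrite mulnS mulnDl mul2n -addnn.
have [|R1 R1R cR1] := @fsubset_of_card _ R m; first by lia.
have [|R2 R2R cR2] := @fsubset_of_card _ (R `\` R1)%fset m.
  by rewrite cardfsDS // cR1; lia.
have [R2R' R21] : (R2 `<=` R)%fset /\ [disjoint R2 & R1]%fset.
  by move: R2R; rewrite fsubsetD => /andP[].
pose R3 := ((R `\` R1) `\` R2)%fset.
have R3R : (R3 `<=` R)%fset by rewrite (fsubset_trans (fsubsetDl _ _)) ?fsubsetDl.
have [|| T [cT TR TX]] := IH m R3.
- by move=> r /(fsubsetP R3R)/uR.
- by rewrite cardfsDS // cardfsDS // cR1 cR2; lia.
have uRi R' : (R' `<=` R)%fset ->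
    forall r, r \in R' -> u r != s /\ deg (u r - s) = r.
  by move=> /fsubsetP sub r /sub/uR[].
have [V1R cV1] := diffs_deg_in_image (uRi _ R1R).
have [/diffs_deg_in_opp[V2R +] cV2] := diffs_deg_in_image (uRi _ R2R').
rewrite {}cV2.
set V1 := [fset u r | r in R1]%fset in V1R cV1.
set V2 := [fset - x | x in _]%fset in V2R *; move=> cV2.
have [|cV V] := diffs_deg_in_sumset V1R V2R; first by rewrite fdisjoint_sym.
have [|cVT VT] := diffs_deg_in_sumset V TR.
  apply/fdisjointP => r; rewrite !inE => /orP[->|->]; rewrite ?andbF //.
exists (sumset (sumset V1 V2) T); split.
- by rewrite cVT cV cV1 cV2 cR1 cR2 cT mulnn -expnD mulnS.
- apply: diffs_deg_inW VT; rewrite !fsubUset R1R R2R'; exact: R3R.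
(* The two new blocks together contribute a single difference [u r1 - u r2] in [B], so a pair of
   blocks costs only one factor [S / N]. *)
have sub : (sumset (sumset (sumset V1 V2) T) X `<=` sumset T (sumset X B))%fset.
  apply/fsubsetP => _ /sumsetP[_ [x [/sumsetP[v [t [vV tT ->]]] xX ->]]].
  case/sumsetP: vV => _ [w [/imfsetP[/= r1 rR1 ->] wV2 ->]].
  case/imfsetP: wV2 => /= _ /imfsetP[/= r2 rR2 ->] ->.
  rewrite [X in X \in _](_ : _ = t + (x + (u r1 - u r2))); last by ring.
  rewrite !mem_sumset // AB //.
    by have [] := uR _ (fsubsetP R1R _ rR1).
  by have [] := uR _ (fsubsetP R2R' _ rR2).
apply: leq_trans (_ : #|` sumset T (sumset X B)| * N ^ h.+1 <= _)%N.
  by rewrite leq_mul2r fsubset_leq_card ?orbT.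
rewrite expnS mulnA (leq_trans (leq_mul (XB T) (leqnn _))) // -mulnA.
by rewrite expnS -mulnA leq_mul2l TX orbT.
Qed.

Lemma mem_addsub (V : zmodType) (A : {fset V}) a b c :
  a \in A -> b \in A -> c \in A -> a + b - c \in addsub_fset A.
Proof.
move=> aA bA cA; apply/imfsetP; exists (a, b, c) => //=.
by rewrite !in_fsetM /= aA bA.
Qed.

(* If [#|` R|] is the number of distinct degrees of [u - s] with [u \in A], this
   is [#|` R| <= C_h |A| ^ (1 / 2h) (|A + A - A| / |A|) ^ (1 / 2)]. *)
Lemma separated_card (F : fieldType) (A : {fset laurent F}) (s : laurent F)
    (R : {fset int}) (h : nat) :
  A != fset0 ->
  (forall r, r \in R -> exists u, [/\ u \in A, u != s & deg (u - s) = r]) ->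
  ((#|` R| %/ (2 * h)) ^ (2 * h) * #|` A| ^ h <=
    #|` addsub_fset A| ^ h * #|` A|)%N.
Proof.
move=> A0 RA; pose B := [fset (a - b)%R | a in A, b in A]%fset.
have AB a a' : a \in A -> a' \in A -> a - a' \in B.
  by move=> aA a'A; exact: in_imfset2.
have ABE : sumset A B = addsub_fset A.
  apply/fsetP => x; apply/sumsetP/imfsetP => /=.
    move=> [a [_ [aA /imfset2P[/= b bA [c cA ->]] ->]]].
    by exists (a, b, c); rewrite /= ?addrA // !in_fsetM /= aA bA.
  move=> [[[a b] c]]; rewrite !in_fsetM /= => /andP[/andP[aA bA] cA] ->.
  by exists a, (b - c); rewrite addrA AB.
have [X [X0 XA XB]] := plunnecke B A0; rewrite ABE in XB.
have [|u uR] := @boolp.choice int (laurent F) (fun r v => r \in R ->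
    [/\ v \in A, v != s & deg (v - s) = r]).
  by move=> r; have [/RA[v]|] := boolP (r \in R); [exists v|exists 0].
have [|T [cT _ TX]] := separated_growth AB XB (h := h) (m := #|` R| %/ (2 * h)) uR.
  by rewrite mulnC leq_divM.
(* Translation by an element of the nonempty [X] gives [|T| <= |T + X|]; on the right,
   [|X| <= |A|]. *)
rewrite -cT (leq_trans (leq_mul _ (leqnn _)) (leq_trans TX _)) //.
  by rewrite sumsetC card_sumset_le.
by rewrite leq_mul2l fsubset_leq_card ?orbT.
Qed.

(** * Counting *)

Lemma card_fibers (T : finType) (U : choiceType) (X : {set T}) (f : T -> U)
    (Y : {fset U}) :
  (forall x, x \in X -> f x \in Y) ->
  #|X| = (\sum_(y <- Y) #|[set x in X | f x == y]|)%N.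
Proof.
move=> XY; transitivity (\sum_(y <- Y) \sum_(x in X) (f x == y))%N.
  rewrite exchange_big /= -sum1_card; apply: eq_bigr => x xX.
  rewrite -big_mkcond /= sum1_count -(eq_count (a1 := pred1 (f x))) => [|y].
    by rewrite count_uniq_mem ?fset_uniq ?XY.
  by rewrite /= eq_sym.
apply: eq_bigr => y _; rewrite -sum1_card -big_mkcondr /=.
by apply: eq_bigl => x; rewrite inE.
Qed.

Lemma card_le_fibers (T : finType) (U : choiceType) (X : {set T}) (f : T -> U)
    (Y : {fset U}) (k : nat) :
  (forall x, x \in X -> f x \in Y) ->
  (forall y, #|[set x in X | f x == y]| <= k)%N ->
  (#|X| <= k * #|` Y|)%N.
Proof.
move=> XY fk; rewrite (card_fibers XY).
apply: leq_trans (leq_sum _ (fun y _ => fk y)) _.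
by rewrite big_const_seq count_predT iter_addn_0.
Qed.

Lemma sum_sqr_le (I : Type) (s : seq I) (r : I -> nat) :
  ((\sum_(i <- s) r i) ^ 2 <= size s * \sum_(i <- s) r i ^ 2)%N.
Proof.
elim: s => [|i s IH]; first by rewrite !big_nil.
rewrite !big_cons /= sqrnD.
have cross : (2 * (r i * \sum_(j <- s) r j) <=
    size s * r i ^ 2 + \sum_(j <- s) r j ^ 2)%N.
  rewrite mulnA big_distrr /=.
  have -> : (size s * r i ^ 2 = \sum_(j <- s) r i ^ 2)%N.
    by rewrite big_const_seq count_predT iter_addn_0 mulnC.
  rewrite -big_split /=; apply: leq_sum => j _.
  by rewrite -mulnA nat_Cauchy.
by rewrite mulSn !mulnDr; lia.
Qed.

(** Cauchy-Schwarz over the fibres of [f]: the squares of the fibre sizes add up to the number of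
    colliding pairs. *)
Lemma collision_bound (T : finType) (U : choiceType) (X : {set T}) (f : T -> U)
    (Y : {fset U}) :
  (forall x, x \in X -> f x \in Y) ->
  (#|X| ^ 2 <=
    #|` Y| * #|[set p in finset.setX X X | f p.1 == f p.2]|)%N.
Proof.
move=> XY; rewrite (card_fibers XY) (leq_trans (sum_sqr_le _ _)) // leq_mul2l.
apply/orP; right; set C := [set p in _ | _].
have CY p : p \in C -> f p.1 \in Y.
  by rewrite !inE => /andP[/andP[/XY]].
rewrite (card_fibers CY) leq_sum // => y _.
rewrite -mulnn -cardsX subset_leq_card //; apply/fintype.subsetP => -[x x'].
by rewrite !inE /= => /andP[/andP[-> /eqP ->] /andP[-> /eqP ->]]; rewrite !eqxx.
Qed.

(** * Nearest neighbours *)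

(** Compares absolute values. Zero has to be placed first by hand, since its [deg] is a mere
    default. *)
Definition size_le (F : fieldType) (f g : laurent F) : bool :=
  (f == 0) || ((g != 0) && (deg f <= deg g)).

(** Sort by [size_le] and cut in the middle. Zero sorts first and the lower half is nonempty, so
    zero cannot occur in the upper half. *)
Lemma degree_split (F : fieldType) (A : {fset laurent F}) : (1 < #|` A|)%N ->
  exists A0 A1 : {set A}, [/\ #|A0| = #|` A|./2, #|A1| = (#|` A| - #|` A|./2)%N,
    forall a, a \in A1 -> val a != 0 &
    forall u a, u \in A0 -> a \in A1 -> val u != 0 -> deg (val u) <= deg (val a)].
Proof.
move=> A2; pose le (u v : A) := size_le (val u) (val v).
pose s := sort le (enum {: A}); pose k := #|` A|./2.
have ss : size s = #|` A| by rewrite size_sort -cardE cardfE.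
have us : uniq s by rewrite sort_uniq enum_uniq.
have kA : (k <= size s)%N by rewrite ss /k -divn2 leq_div.
have leS_total : total le.
  move=> u v; rewrite /le /size_le.
  by case: eqP => //= _; case: eqP => //= _; exact: le_total.
have leS_trans : transitive le.
  move=> v u w; rewrite /le /size_le; case: eqP => //= _ /andP[/negPf -> uv] /=.
  by move=> /andP[-> vw]; exact: le_trans vw.
have s_le u a : u \in take k s -> a \in drop k s -> le u a.
  move=> uk ak; have := sort_sorted leS_total (enum {: A}).
  rewrite (sorted_pairwise leS_trans) -/s -(cat_take_drop k s) pairwise_cat.
  by case/andP => /allrelP le_all _; exact: le_all.
have s_uniq u : u \in take k s -> u \in drop k s -> False.
  move: us; rewrite -{1}(cat_take_drop k s) cat_uniq => /and3P[_ /hasPn disj _].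
  by move=> uk /disj; rewrite /= uk.
have dropN0 a : a \in drop k s -> val a != 0.
  move=> ak; apply/eqP => a0.
  have : (0 < size (take k s))%N by rewrite size_takel // half_gt0.
  case E : (take k s) => [//|u s'] _.
  have uk : u \in take k s by rewrite E mem_head.
  have := s_le _ _ uk ak; rewrite /le /size_le a0 eqxx orbF => /eqP u0.
  by apply: (s_uniq u uk); rewrite (_ : u = a) //; apply: val_inj; rewrite u0.
exists [set u in take k s], [set a in drop k s]; split.
- by rewrite cardsE (card_uniqP _) ?take_uniq // size_takel.
- by rewrite cardsE (card_uniqP _) ?drop_uniq // size_drop ss.
- by move=> a; rewrite inE => /dropN0.
move=> u a; rewrite !inE => uk ak /negPf u0.
by have := s_le _ _ uk ak; rewrite /le /size_le u0 => /andP[].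
Qed.

Definition rep (F : fieldType) (A : {fset laurent F}) (A0 : {set A}) (a a' : A) :
    {set A * A} :=
  [set p | [&& p.1 \in A0, p.2 \in A0 & val a * val p.2 == val a' * val p.1]].

Lemma card_rep_diag (F : fieldType) (A : {fset laurent F}) (A0 : {set A}) (a : A) :
  val a != 0 -> (#|rep A0 a a| <= #|A0|)%N.
Proof.
move=> a0; rewrite -(card_in_imset (f := fst)); last first.
  move=> [u v] [u' v']; rewrite !inE /= => /and3P[_ _ /eqP/(mulfI a0) uv].
  by move=> /and3P[_ _ /eqP/(mulfI a0) uv'] uu'; congr pair => //;
  apply: val_inj; exact: etrans uv (etrans (congr1 val uu') (esym uv')).
apply/subset_leq_card/fintype.subsetP => _ /imsetP[p + ->].
by rewrite inE => /andP[].
Qed.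

(** With [n = |A0|], Cauchy-Schwarz bounds [(|I| n)^2] by [P] times the number of coincidences
    [a v = a' u]. The diagonal gives at most [n] for each [a], every other pair at most [n^2 / 2P];
    hence [2 (|I| n)^2 <= (|I| n)^2 + 2P |I| n]. *)
Lemma sparse_rep_card (F : fieldType) (A : {fset laurent F}) (A0 I : {set A}) :
  (forall a, a \in I -> val a != 0) ->
  (forall a a', a \in I -> a' \in I -> a != a' ->
    2 * #|` mul_fset A| * #|rep A0 a a'| <= #|A0| ^ 2)%N ->
  (#|I| * #|A0| <= 2 * #|` mul_fset A|)%N.
Proof.
set P := #|` mul_fset A|; set n := #|A0| => I0 Irep.
pose X := finset.setX I A0; pose f (p : A * A) := val p.1 * val p.2.
have fX p : p \in X -> f p \in mul_fset A.
  by move=> _; rewrite in_imfset2 ?fsvalP.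
have := collision_bound fX; rewrite cardsX -/n -/P.
set C := [set p in _ | _].
have CE : (#|C| <= \sum_(a in I) \sum_(a' in I) #|rep A0 a a'|)%N.
  rewrite pair_big_dep /= -sum1_card.
  rewrite (partition_big (fun p : (A * A) * (A * A) => (p.1.1, p.2.1))
    (fun q : A * A => (q.1 \in I) && (q.2 \in I))) /=; last first.
    by move=> p; rewrite !inE => /andP[/andP[/andP[-> _] /andP[-> _]] _].
  apply: leq_sum => -[a a'] _; rewrite sum1dep_card.
  (* The collision of [(a, v)] with [(a', u)] is read as [(u, v)], the order used in [rep]. *)
  rewrite -(card_in_imset (f := fun p : (A * A) * (A * A) => (p.2.2, p.1.2))).
    apply/subset_leq_card/fintype.subsetP => y /imsetP[[[b v] [b' u]] + ->{y}].
    rewrite !inE /= => /andP[/andP[/andP[/andP[_ vA0] /andP[_ uA0]] E] /eqP[<- <-]].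
    by rewrite uA0 vA0.
  move=> [[b v] [b' u]] [[c w] [c' x]] /=.
  by rewrite !inE /= => /andP[_ /eqP[-> ->]] /andP[_ /eqP[-> ->]] [-> ->].
have bound : (2 * P * \sum_(a in I) \sum_(a' in I) #|rep A0 a a'| <=
    \sum_(a in I) \sum_(a' in I) (n ^ 2 + (a == a') * (2 * P * n)))%N.
  rewrite big_distrr /=; apply: leq_sum => a aI; rewrite big_distrr /=.
  apply: leq_sum => a' a'I; have [<-|aa'] := eqVneq a a'.
    by rewrite mul1n (leq_trans _ (leq_addl _ _)) // leq_mul2l card_rep_diag ?orbT ?I0.
  by rewrite mul0n addn0 Irep.
have sumE : (\sum_(a in I) \sum_(a' in I) (n ^ 2 + (a == a') * (2 * P * n)) =
    #|I| * (#|I| * n ^ 2 + 2 * P * n))%N.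
  rewrite -sum_nat_const; apply: eq_bigr => a aI.
  rewrite big_split /= sum_nat_const; congr addn.
  rewrite (bigD1 a) //= eqxx mul1n big1 ?addn0 // => a' /andP[_ /negPf].
  by rewrite eq_sym => ->; rewrite mul0n.
rewrite sumE in bound; move: CE bound.
move: (\sum_(a in I) _)%N #|C| #|I| => S c i cS bound col.
have [->//|i0] := posnP (i * n); rewrite -(leq_pmul2l i0).
have : (P * c <= P * S)%N by rewrite leq_mul2l cS orbT.
by move: bound col; rewrite -!mulnn; lia.
Qed.

Lemma coefB_laurent (F : fieldType) (f g : laurent F) (i : int) :
  (f - g)%R i = f i - g i.
Proof. by []. Qed.

Lemma exists_nearest (T : finType) (D : {set T}) (adj : rel T) (d : T -> T -> int) :
  exists nb : T -> T, forall a, [exists b in D, adj a b] ->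
    [/\ nb a \in D, adj a (nb a) &
      forall b, b \in D -> adj a b -> d a (nb a) <= d a b].
Proof.
have [|nb nbP] := @boolp.choice T T (fun a c => [exists b in D, adj a b] ->
    [/\ c \in D, adj a c & forall b, b \in D -> adj a b -> d a c <= d a b]).
  move=> a; have [/existsP[b0 /= Pb0]|] := boolP [exists b in D, adj a b].
    2: by exists a.
  case: (@arg_minP _ _ _ b0 (fun b => (b \in D) && adj a b) (d a) Pb0).
  move=> c /andP[cD ac] cmin.
  by exists c => _; split => // b bD ab; apply: cmin; rewrite bD.
by exists nb.
Qed.

(** [R] may be any part of the set of distances from [s]; bounding the size of every such [R] bounds
    the number of distances. *)
Definition radii (F : fieldType) (A : {fset laurent F}) (s : laurent F)
    (R : {fset int}) : Prop :=
  forall r, r \in R -> exists u, [/\ u \in A, u != s & deg (u - s) = r].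

(* For fixed [s], the centres [a] with the same radius [r] and the same
   coefficient of [t^r] in [s - a] lie in a ball of radius [r - 1], so none of
   them is adjacent to another. *)
Lemma card_centres (F : finFieldType) (A : {fset laurent F}) (D : {set A})
    (adj : rel A) (nb : A -> A) (k L : nat) (s : laurent F) :
  (forall I : {set A}, I \subset D ->
    (forall a a', a \in I -> a' \in I -> a != a' -> ~~ adj a a') -> (#|I| <= k)%N) ->
  (forall R, radii A s R -> (#|` R| <= L)%N) ->
  (forall a, a \in D -> nb a != a) ->
  (forall a b, a \in D -> b \in D -> adj a b ->
    deg (val (nb a) - val a) <= deg (val b - val a)) ->
  (#|[set a in D | `[< forall i, (deg (val (nb a) - val a) < i)%R ->
      (s - val a)%R i = 0%R >] ]| <= k * #|F| * L)%N.
Proof.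
move=> indep RL nb_neq nb_min; pose rho a := deg (val (nb a) - val a).
set W := [set a in D | _].
(* Membership in the ball is stated by vanishing coefficients, which also covers [s = a], where
   [deg (s - a)] is a default. *)
have WP a : a \in W -> a \in D /\ forall i, rho a < i -> (s - val a) i = 0.
  by rewrite inE => /andP[aD /asboolP].
pose R := [fset rho a | a in W]%fset.
have Rle : (#|` R| <= L)%N.
  apply: RL => _ /imfsetP[/= a /WP[aD aW] ->].
  have nba : val (nb a) - val a != 0 by rewrite subr_eq0 nb_neq.
  have nbE : val (nb a) - s = (val (nb a) - val a) - (s - val a) by ring.
  (* The radius [rho a] is the distance from [s] to a point of [A]: to [nb a] if [s] is strictly
     inside the ball, to [a] itself otherwise. *)
  have [as_r|as_r] := eqVneq ((s - val a) (rho a)) 0.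
    have nbr : (val (nb a) - s) (rho a) != 0.
      by rewrite nbE coefB_laurent as_r subr0 degP.
    exists (val (nb a)); rewrite fsvalP; split => //.
      by rewrite -subr_eq0; apply/eqP => E; rewrite E eqxx in nbr.
    apply: deg_eq => // i ri.
    by rewrite nbE coefB_laurent (coef_gt_deg ri) aW // subr0.
  have sa : s - val a != 0 by apply/eqP => E; rewrite E eqxx in as_r.
  exists (val a); rewrite fsvalP; split => //; first by rewrite eq_sym -subr_eq0.
  rewrite -degN opprB; exact: deg_eq.
have WR a : a \in W -> rho a \in R by move=> aW; apply/imfsetP; exists a.
rewrite (leq_trans (card_le_fibers (k := k * #|F|) WR _)) ?leq_mul2l ?Rle ?orbT //.
move=> r; set Wr := [set a in W | _].
have -> : #|F| = #|` [fset x in enum F]%fset|.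
  by rewrite card_fseq undup_id ?enum_uniq // cardE.
apply: (@card_le_fibers _ _ _ (fun a => (s - val a) r)) => [a _|x].
  by rewrite inE mem_enum.
apply: indep => [|a b].
  by apply/fintype.subsetP => a; rewrite !inE => /andP[/andP[/andP[]]].
rewrite inE => /andP[+ /eqP ax]; rewrite inE => /andP[/WP[aD aW] /eqP ar].
rewrite inE => /andP[+ /eqP bx]; rewrite inE => /andP[/WP[bD bW] /eqP br] ab.
apply/negP => /(nb_min _ _ aD bD); rewrite -/(rho a) ar => rab.
have ba : val b - val a != 0 by rewrite subr_eq0 eq_sym.
move: rab (degP ba); set d := deg _ => rab.
rewrite (_ : val b - val a = (s - val a) - (s - val b)); last by ring.
rewrite coefB_laurent => /eqP; apply.
move: rab; rewrite le_eqVlt => /orP[/eqP <-|rlt]; first by rewrite ax bx subrr.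
by rewrite aW ?bW ?subrr // ?ar ?br.
Qed.

(** For [p = (u, v)], [a v = a' u] gives [a (v - u) = (a' - a) u], and [|u| <= |a|]. *)
Lemma deg_rep_diff (F : fieldType) (A : {fset laurent F}) (A0 : {set A})
    (a a' : A) (p : A * A) :
  p \in rep A0 a a' -> val a != 0 -> val a' != val a ->
  (val p.1 != 0 -> deg (val p.1) <= deg (val a)) ->
  forall i, deg (val a' - val a) < i -> (val p.2 - val p.1) i = 0.
Proof.
rewrite inE => /and3P[_ _ /eqP E] a0; rewrite -subr_eq0 => a'a ua i di.
have [->//|vu] := eqVneq (val p.2 - val p.1) 0.
have {}E : val a * (val p.2 - val p.1) = (val a' - val a) * val p.1.
  by rewrite mulrBr E mulrBl.
have u0 : val p.1 != 0.
  by apply: contraNneq vu => u0; move/eqP: E; rewrite u0 mulr0 mulf_eq0 (negPf a0).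
apply: coef_gt_deg; apply: le_lt_trans di.
have := congr1 (@deg F) E; rewrite !degM //; have := ua u0; lia.
Qed.

(** By [a (v - u) = (a' - a) u], the difference [v - u] determines [u], and then [v]. *)
Lemma rep_diff_inj (F : fieldType) (A : {fset laurent F}) (A0 : {set A})
    (a a' : A) (p p' : A * A) :
  p \in rep A0 a a' -> p' \in rep A0 a a' -> val a' != val a ->
  val p.2 - val p.1 = val p'.2 - val p'.1 -> p = p'.
Proof.
case: p p' => [u v] [u' v']; rewrite !inE /=.
move=> /and3P[_ _ /eqP E] /and3P[_ _ /eqP E']; rewrite -subr_eq0 => a'a D.
have uu' : val u = val u'.
  apply: (mulfI a'a); rewrite !mulrBl -E -E' -!mulrBr; congr (_ * _); exact: D.
have vv' : val v = val v' by rewrite -(subrK (val u) (val v)) D uu' subrK.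
by congr pair; apply: val_inj.
Qed.

Lemma energy_count (F : finFieldType) (A : {fset laurent F}) (L : nat) :
  (1 < #|` A|)%N ->
  (forall s R, radii A s R -> (#|` R| <= L)%N) ->
  (#|` A| ^ 4 <=
    432 * #|` mul_fset A| ^ 2 * #|` addsub_fset A| * #|F| * L)%N \/
  (#|` A| ^ 2 <= 24 * #|` mul_fset A|)%N.
Proof.
move=> A2 RL; have [A0 [A1 [cA0 cA1 A1n0 A01]]] := degree_split A2.
set P := #|` mul_fset A|; set S := #|` addsub_fset A|; pose n := #|A0|.
have n0 : (0 < n)%N by rewrite /n cA0 half_gt0.
pose adj (a b : A) := (a != b) && (n ^ 2 <= 2 * P * #|rep A0 a b|)%N.
have indep (I : {set A}) : I \subset A1 ->
    (forall a a', a \in I -> a' \in I -> a != a' -> ~~ adj a a') ->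
    (#|I| * n <= 2 * P)%N.
  move=> /fintype.subsetP IA1 Iadj; apply: sparse_rep_card => [a /IA1/A1n0//|].
  move=> a a' aI a'I aa'; have := Iadj _ _ aI a'I aa'.
  by rewrite /adj aa' /= -ltnNge => /ltnW.
have [nb nbP] := exists_nearest A1 adj (fun a b => deg (val b - val a)).
pose D := [set a in A1 | [exists b in A1, adj a b]].
have DP a : a \in D -> a \in A1 /\ [exists b in A1, adj a b].
  by rewrite inE => /andP[].
have DA1 : D \subset A1 by apply/fintype.subsetP => a /DP[].
have isolated : (#|A1 :\: D| * n <= 2 * P)%N.
  apply: indep => [|a b]; first exact: subsetDl.
  rewrite !inE => /andP[+ aA1] /andP[_ bA1] _; rewrite aA1 /=.
  by apply: contra => ab; apply/existsP; exists b; rewrite bA1.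
have nb_neq a : a \in D -> val (nb a) != val a.
  move=> /DP[_ /nbP[_ /andP[+ _] _]]; rewrite eq_sym; apply: contra => /eqP E.
  by apply/eqP; exact: val_inj.
have centres s := @card_centres F A D adj nb (2 * P %/ n) L s.
pose Tu := [set t : A * (A * A) | (t.1 \in D) && (t.2 \in rep A0 t.1 (nb t.1))].
have TuP t : t \in Tu -> t.1 \in D /\ t.2 \in rep A0 t.1 (nb t.1).
  by rewrite finset.in_set => /andP[].
(* Each [a] in [D] is adjacent to [nb a], so it lies in at least [n^2 / 2P] triples. *)
have TuE : (#|D| * n ^ 2 <= 2 * P * #|Tu|)%N.
  have -> : #|Tu| = (\sum_(a in D) #|rep A0 a (nb a)|)%N.
    under [RHS]eq_bigr do rewrite -sum1_card.
    by rewrite pair_big_dep /= sum1dep_card.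
  rewrite big_distrr -sum_nat_const /=.
  by apply: leq_sum => a /DP[_ /nbP[_ /andP[_ +] _]].
pose g (t : A * (A * A)) := val t.1 + val t.2.2 - val t.2.1.
have gTu t : t \in Tu -> g t \in addsub_fset A.
  by move=> _; rewrite mem_addsub ?fsvalP.
(* In the fibre over [y] the centre [a] determines [(u, v)], and [y] lies in the ball about [a]
   through [nb a]; so it suffices to count centres. *)
have fiber y : (#|[set t in Tu | g t == y]| <= 2 * P %/ n * #|F| * L)%N.
  apply: leq_trans (centres y _ (RL y) _ _).
  - rewrite -(card_in_imset (f := fst)).
      apply/subset_leq_card/fintype.subsetP => _ /imsetP[[a p] + ->].
      rewrite finset.in_set => /andP[/TuP[/= aD ap] /eqP <-].
      have [aA1 _] := DP a aD; rewrite finset.in_set aD; apply/asboolP => i di.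
      have: (val p.2 - val p.1) i = 0.
        apply: (deg_rep_diff ap) => //; [exact: A1n0|exact: nb_neq|].
        by apply: A01 => //; move: ap; rewrite inE => /and3P[].
      by move=> /= E; rewrite -[RHS]E; ring.
    move=> [a p] [a' p']; rewrite finset.in_set => /andP[/TuP[/= aD ap] /eqP E].
    rewrite finset.in_set => /andP[/TuP[/= _ ap'] /eqP E'] aa'.
    rewrite -{a'}aa' in ap' E' *.
    congr pair; apply: (rep_diff_inj ap ap'); first exact: nb_neq.
    by move: E; rewrite -E' /g /= -!addrA => /addrI.
  - move=> I ID Iadj; rewrite leq_divRL //; apply: indep => //.
    exact: fintype.subset_trans DA1.
  - by move=> a aD; apply: contraNneq (nb_neq a aD) => ->.
  - move=> a b /DP[_ /nbP[_ _ nbmin]] /DP[bA1 _]; exact: nbmin.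
have TuS := card_le_fibers gTu fiber; rewrite -/S in TuS.
have kn : (2 * P %/ n * n <= 2 * P)%N by rewrite leq_divM.
have cD : (#|D| + #|A1 :\: D| = #|A1|)%N.
  by rewrite -(cardsID D A1) (finset.setIidPr DA1).
have Nn : (#|` A| <= 3 * n)%N by rewrite /n cA0; lia.
have Nm : (#|` A| <= 2 * #|A1|)%N by rewrite cA1; lia.
move: isolated TuE TuS kn cD Nn Nm; clearbody n P S.
move: #|D| #|A1| #|A1 :\: D| #|` A| #|Tu| (_ %/ _)%N #|F|.
move=> d m e N T k q isolated TuE TuS kn cD Nn Nm.
(* If [m n < 4P], then [N^2 <= 6 m n <= 24 P]. Otherwise the isolated points account for at most
   half of [m n], and [N^4 <= 54 m n^3 <= 108 d n^3 <= 432 P^2 S q L]. *)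
have [big|/ltnW small] := leqP (4 * P) (m * n); [left|right]; last first.
  by rewrite -mulnn (leq_trans (leq_mul Nn Nm)) //; lia.
have mn : (m * n <= 2 * (d * n))%N by rewrite -cD mulnDl in big *; lia.
have H1 : (N ^ 4 <= 54 * (m * n * n ^ 2))%N.
  have -> : (54 * (m * n * n ^ 2) = (3 * n) ^ 3 * (2 * m))%N by lia.
  by rewrite expnSr leq_mul // leq_exp2r.
have H2 : (m * n * n ^ 2 <= 2 * (d * n ^ 2) * n)%N.
  by have -> : (2 * (d * n ^ 2) * n = 2 * (d * n) * n ^ 2)%N by [lia]; rewrite leq_mul.
have H3 : (d * n ^ 2 * n <= 2 * P * (k * q * L * S) * n)%N.
  by rewrite leq_mul // (leq_trans TuE) // leq_mul.
have H4 : (2 * P * (k * q * L * S) * n <= 2 * P * (q * L * S) * (2 * P))%N.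
  have -> : (2 * P * (k * q * L * S) * n = 2 * P * (q * L * S) * (k * n))%N by lia.
  by rewrite leq_mul.
by rewrite -(mulnn P); lia.
Qed.

(** * The theorem *)

(** This is the [2h]-th root of [separated_card]. Here [z] stands for [(S / N) N^(1/h)] and is
    specified by its [h]-th power, which avoids real exponents. *)
Lemma radii_le (R : realType) (F : fieldType) (A : {fset laurent F}) (h : nat)
    (s : laurent F) (D : {fset int}) (z : R) :
  (0 < h)%N -> A != fset0 ->
  0 <= z -> z ^+ h = (#|` addsub_fset A|%:R / #|` A|%:R) ^+ h * #|` A|%:R ->
  radii A s D -> #|` D|%:R <= (2 * h)%:R * (Num.sqrt z + 1) :> R.
Proof.
move=> h0 A0 z0 zh /(separated_card h A0).
set d := (_ %/ _)%N; set S := #|` addsub_fset A|; set N := #|` A| => H.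
have N0 : 0 < N%:R :> R by rewrite ltr0n cardfs_gt0.
have dz : d%:R <= Num.sqrt z.
  rewrite -(@ler_pXn2r _ 2) ?nnegrE ?sqrtr_ge0 // sqr_sqrtr //.
  rewrite -(ler_pXn2r h0) ?nnegrE ?exprn_ge0 // zh -exprM expr_div_n mulrAC.
  by rewrite ler_pdivlMr ?exprn_gt0 // -!natrX -!natrM ler_nat.
(* Rounding in the quotient [d] is what costs the summand 1 beside [Num.sqrt z]. *)
have : (#|` D| <= 2 * h * d.+1)%N.
  by rewrite ltnW // mulnC ltn_ceil // muln_gt0.
rewrite -(ler_nat R) natrM => /le_trans; apply.
by rewrite ler_wpM2l // -natr1 lerD2r.
Qed.

Lemma card_addsub_ge (V : zmodType) (A : {fset V}) : (#|` A| <= #|` addsub_fset A|)%N.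
Proof.
apply/fsubset_leq_card/fsubsetP => a aA.
by rewrite -(addrK a a) mem_addsub.
Qed.

(* The last hypothesis only excludes A empty with eps >= 9, where
   |A| ^ (9 - eps) is a nonpositive power of 0. *)
Theorem theorem1p6 (R : realType) (eps : R) (heps : 0 < eps) :
  exists c : R, 0 < c /\
    forall (q : nat) (F : finFieldType) (hq : #|F| = q)
           (A : {fset laurent F}) (hA : A != fset0 \/ eps < 9),
      c * (q%:R ^- 2 * #|` A|%:R `^ (9 - eps)) <=
      #|` addsub_fset A|%:R ^+ 3 * #|` mul_fset A|%:R ^+ 4.
Proof.
(* With [1 / h <= eps], the factor [y = N^(1/h)] lost in [radii_le] is at most [N^eps]. *)
pose h := (Num.truncn eps^-1).+1.
have h1 : 1 <= h%:R :> R by rewrite ler1n.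
have heps' : h%:R^-1 <= eps.
  by rewrite invf_ple ?posrE ?ltr0n // ltW // truncnS_gt.
(* The factor 432 is from [energy_count], [4 h] from the bound [Lz] on [L]; the square is there
   because the count gets squared. *)
pose K : R := (432 * (4 * h%:R)) ^+ 2.
have h0 : 0 < h%:R :> R by rewrite ltr0n.
have K0 : 0 < K by rewrite exprn_gt0 ?mulr_gt0 ?ltr0n.
exists K^-1; split; first by rewrite invr_gt0.
move=> q F hq A hA.
have [A0|A0] := eqVneq A fset0.
  rewrite A0 cardfs0 powR0 ?mulr0 ?mulr_ge0 ?exprn_ge0 //.
  by rewrite subr_eq0 gt_eqF //; case: hA; rewrite // A0 eqxx.
set S := #|` addsub_fset A|; set P := #|` mul_fset A|; set N := #|` A|.
have NS : N%:R <= S%:R :> R by rewrite ler_nat card_addsub_ge.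
have N1 : 1 <= N%:R :> R by rewrite ler1n cardfs_gt0.
have q1 : 1 <= q%:R :> R by rewrite -hq ler1n; apply/card_gt0P; exists 0.
have N0 : 0 < N%:R :> R by exact: lt_le_trans N1.
have q0 : 0 < q%:R :> R by exact: lt_le_trans q1.
rewrite mulrC ler_pdivrMr // mulrC ler_pdivrMr ?exprn_gt0 //.
pose y : R := N%:R `^ h%:R^-1.
have y1 : 1 <= y by rewrite -(powRr0 N%:R) ler_powR // invr_ge0.
have yh : y ^+ h = N%:R.
  by rewrite -powR_mulrn ?powR_ge0 // -powRrM mulVf ?powRr1 // gt_eqF.
have Neps : N%:R `^ (9 - eps) * y <= N%:R ^+ 9.
  rewrite -powRD; last by rewrite (gt_eqF N0) implybT.
  rewrite -(powR_mulrn 9 (ltW N0)) ler_powR //; lra.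
pose z : R := S%:R / N%:R * y.
have z1 : 1 <= z by rewrite mulr_ege1 // ler_pdivlMr // mul1r.
have z0 : 0 <= z by exact: le_trans z1.
pose L := Num.truncn ((2 * h)%:R * (Num.sqrt z + 1)).
(* As [z >= 1], the summand 1 is absorbed by doubling [Num.sqrt z]. *)
have Lz : L%:R <= 4 * h%:R * Num.sqrt z.
  have : L%:R <= (2 * h)%:R * (Num.sqrt z + 1).
    by rewrite -truncn_ge_nat // mulr_ge0 // addr_ge0 ?sqrtr_ge0.
  have : 1 <= Num.sqrt z by rewrite -sqrtr1 ler_sqrt.
  by rewrite natrM; nra.
have radiiL s D : radii A s D -> (#|` D| <= L)%N.
  move=> sD; rewrite truncn_ge_nat; last by rewrite mulr_ge0 // addr_ge0 ?sqrtr_ge0.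
  by apply: radii_le sD; rewrite // exprMn yh.
(* [energy_count] needs two elements; a singleton satisfies the second alternative. *)
have count : (N ^ 4 <= 432 * P ^ 2 * S * q * L)%N \/ (N ^ 2 <= 24 * P)%N.
  have [N2|N1'] := ltnP 1 N; first by rewrite -hq; exact: energy_count.
  right; have P0 : (0 < P)%N.
    rewrite cardfs_gt0; case/fset0Pn: A0 => a aA.
    by apply/fset0Pn; exists (a * a); exact: in_imfset2.
  by rewrite -mulnn (leq_trans (leq_mul N1' N1')) // muln_gt0.
have y0 : 0 < y by exact: lt_le_trans y1.
case: count; rewrite -(ler_nat R) => count.
- rewrite !(natrM _ _ L, natrM _ _ q, natrM _ _ S) (natrM _ 432) !natrX in count.
  have L2 : L%:R ^+ 2 <= (4 * h%:R) ^+ 2 * z.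
    by rewrite -[z]sqr_sqrtr // -exprMn lerXn2r ?nnegrE // !mulr_ge0 ?sqrtr_ge0.
  (* Square the count and multiply by [N]: since [z N = S y], the right side becomes
     [K q^2 S^3 P^4 y], and [y] is the factor that [Neps] provides on the left. *)
  rewrite -(ler_pM2r y0) (le_trans Neps) //.
  have -> : N%:R ^+ 9 = (N%:R ^+ 4) ^+ 2 * N%:R :> R by ring.
  have -> : S%:R ^+ 3 * P%:R ^+ 4 * K * q%:R ^+ 2 * y =
      (432 * P%:R ^+ 2 * S%:R * q%:R) ^+ 2 * ((4 * h%:R) ^+ 2 * z) * N%:R.
    by rewrite /K /z; field; rewrite gt_eqF.
  have B0 : 0 <= 432 * P%:R ^+ 2 * S%:R * q%:R :> R.
    by rewrite !mulr_ge0 ?exprn_ge0 ?ler0n.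
  rewrite ler_pM2r //.
  apply: le_trans (_ : (432 * P%:R ^+ 2 * S%:R * q%:R * L%:R) ^+ 2 <= _).
    by rewrite lerXn2r ?nnegrE ?exprn_ge0 ?mulr_ge0 ?ler0n.
  by rewrite exprMn ler_wpM2l ?exprn_ge0.
- rewrite (natrM _ 24) natrX in count.
  rewrite -(ler_pM2r y0) (le_trans Neps) //.
  (* Here [N^8 <= (24 P)^4] and [N <= S] already suffice, since the remaining factors [S^2], [q^2]
     and [y] are at least 1. *)
  have N9 : N%:R ^+ 9 <= S%:R * (24 * P%:R) ^+ 4 :> R.
    have -> : N%:R ^+ 9 = N%:R * (N%:R ^+ 2) ^+ 4 :> R by ring.
    by rewrite ler_pM ?exprn_ge0 ?ler0n // lerXn2r ?nnegrE ?exprn_ge0 ?mulr_ge0 ?ler0n.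
  have K24 : 24 ^+ 4 <= K.
    have -> : 24 ^+ 4 = 576 ^+ 2 :> R by ring.
    by rewrite lerXn2r ?nnegrE ?mulr_ge0 ?ler0n //; lra.
  have S1 : 1 <= S%:R :> R by exact: le_trans NS.
  rewrite (le_trans N9) // exprMn.
  have -> : S%:R ^+ 3 * P%:R ^+ 4 * K * q%:R ^+ 2 * y =
      K * (S%:R * P%:R ^+ 4) * (S%:R ^+ 2 * q%:R ^+ 2 * y) by ring.
  rewrite mulrCA -[X in X <= _]mulr1 ler_pM ?mulr_ge0 ?exprn_ge0 ?ler0n //.
    by rewrite ler_wpM2r ?mulr_ge0 ?exprn_ge0 ?ler0n.
  by rewrite !mulr_ege1 ?exprn_ege1.
Qed.
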